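(* With the matrices defined in the context, assume that $M_0,M_1,M_2,M_3$ solve on $[t,T]$ the system $$\dot M_0+\mathcal A^\top M_0+M_0\mathcal A+Q=0,\quad M_0(T)=\bar Q,$$ $$\dot M_1+\mathbb A^\top M_1+M_1\mathbb A-K^\top K=0,\quad M_1(T)=0,$$ $$\dot M_2+\mathbb A^\top M_2-K^\top\widetilde IM_2=0,\quad M_2(T)=\begin{pmatrix}p_0\\0\end{pmatrix},$$ $$\dot M_3+\operatorname{tr}\big(\bar\Sigma\bar\Sigma^\top[M_0+\mathcal J^\top M_1\mathcal J]\big)-(\widetilde IM_2)^\top(\widetilde IM_2)=0,\quad M_3(T)=0,$$ where $K=\big((0,I_N)M_0,(I_N,0)M_0\big)+\widetilde IM_1$. Define $$\bar P_s:=\int_0^1D_r^\top M_0(s)D_r\,dr+\mathcal T^\top M_1(s)\mathcal T,\qquad\bar p_s:=\mathcal T^\top M_2(s),\qquad\bar\eta_s:=M_3(s).$$ Then $(\bar P,\bar p,\bar\eta)$ solves the Riccati system $$\dot P+\mathcal A^\top P+P\mathcal A+\mathcal Q-P\mathcal B\mathcal B^\top P=0,\quad P_T=\mathcal G,$$ $$\dot p+\mathcal A^\top p-P\mathcal B\mathcal B^\top p=0,\quad p_T=\mathfrak g,$$ $$\dot\eta+\operatorname{tr}(\bar\Sigma\bar\Sigma^\top P)-p^\top\mathcal B\mathcal B^\top p=0,\quad\eta_T=0.$$ Hence, by uniqueness for this Riccati system, its solution $(P,p,\eta)$ satisfies $P=\bar P$, $p=\bar p$, $\eta=\bar\eta$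.
   Context: Let $N\ge1$, $0\le t\le T$, $a_i,\sigma_i\in C([0,T];\mathbb R)$, $q_{ij}\ge0$, $\gamma_i\ge0$, $d_i\in\mathbb R$ ($i,j=1,\dots,N$). Define $A_s^N=\operatorname{diag}(a_1(s),\dots,a_N(s))$, $\Sigma_s^N=\operatorname{diag}(\sigma_1(s),\dots,\sigma_N(s))$, $\mathcal A_s=\operatorname{diag}(A_s^N,A_s^N)\in\mathbb R^{2N\times2N}$, $\mathbb A_s=\operatorname{diag}(\mathcal A_s,\mathcal A_s)\in\mathbb R^{4N\times4N}$, $\bar\Sigma_s=\begin{pmatrix}\Sigma_s^N\\0\end{pmatrix}\in\mathbb R^{2N\times N}$, $\mathcal B=\begin{pmatrix}I_N\\ I_N\end{pmatrix}$, $\widetilde I=(\frac12I_N,I_N,\frac13I_N,\frac12I_N)\in\mathbb R^{N\times4N}$, $\mathcal J=\begin{pmatrix}I_{2N}\\ \frac12I_{2N}\end{pmatrix}$, and for $r\in[0,1]$, $D_r=\begin{pmatrix}I_N&-(1-r)I_N\\0&I_N\end{pmatrix}$. Further $$\mathcal T=\begin{pmatrix}\int_0^1D_r\,dr\\ \int_0^1rD_r\,dr\end{pmatrix}=\begin{pmatrix}I_N&-\frac12I_N\\0&I_N\\ \frac12I_N&-\frac16I_N\\0&\frac12I_N\end{pmatrix}.$$ $\widetilde Q\in\mathbb R^{N\times N}$ has entries $\widetilde Q_{ii}=\frac1N\sum_{k\ne i}q_{ik}$, $\widetilde Q_{ij}=-\frac{q_{ij}}N$ for $i\ne j$; $\Gamma=\operatorname{diag}(\gamma_1,\dots,\gamma_N)$,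 $d=(d_1,\dots,d_N)^\top$; $$Q=\begin{pmatrix}0&\widetilde Q^\top\\ \widetilde Q&0\end{pmatrix},\quad\bar Q=\begin{pmatrix}0&\Gamma\\ \Gamma&0\end{pmatrix},\quad p_0=-\begin{pmatrix}0\\ \Gamma d\end{pmatrix},$$ $$\mathcal Q=\int_0^1D_r^\top QD_r\,dr=\begin{pmatrix}0&\widetilde Q^\top\\ \widetilde Q&-\frac12(\widetilde Q+\widetilde Q^\top)\end{pmatrix},\quad\mathcal G=\int_0^1D_r^\top\bar QD_r\,dr=\begin{pmatrix}0&\Gamma\\ \Gamma&-\Gamma\end{pmatrix},\quad\mathfrak g=\int_0^1D_r^\top p_0\,dr=-\begin{pmatrix}0\\ \Gamma d\end{pmatrix}.$$ The unknowns take values $M_0\in\mathbb R^{2N\times2N}$, $M_1\in\mathbb R^{4N\times4N}$, $M_2\in\mathbb R^{4N}$, $M_3\in\mathbb R$, $P\in\mathbb R^{2N\times2N}$, $p\in\mathbb R^{2N}$, $\eta\in\mathbb R$. $I_m$ is the $m\times m$ identity; $(0,I_N)$ and $(I_N,0)$ are $N\times2N$ matrices. *)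

(* Defs.v *)
From HB Require Import structures.
From mathcomp Require Import all_boot all_order all_algebra.
From mathcomp Require Import all_classical all_reals all_analysis.

Set Implicit Arguments.
Unset Strict Implicit.
Unset Printing Implicit Defensive.

Import Order.TTheory GRing.Theory Num.Theory.
Import numFieldNormedType.Exports.

Local Open Scope classical_set_scope.
Local Open Scope ring_scope.

(* The difference quotient is only taken at points [h + s] of [D]; for
   [D = `[t, T]] with [t < T] this is the usual derivative at interior points
   and the one-sided derivative at the two endpoints. At an isolated point of
   [D] (the case [t = T]) the condition is vacuous, so that solving an ODE there
   reduces to satisfying its terminal condition. *)
Definition is_derive_within (R : realType) (V : normedModType R) (D : set R)
    (F : R -> V) (s : R) (dF : V) : Prop :=
  (fun h : R => h^-1 *: (F (h + s) - F s))
    @ within [set h | D (h + s)] (0 : R)^' --> dF.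

(* Entrywise Lebesgue integral over [0, 1]. *)
Definition mx_integral01 (R : realType) (m n : nat) (F : R -> 'M[R]_(m, n)) :
    'M[R]_(m, n) :=
  \matrix_(i, j) (\int[@lebesgue_measure R]_(r in `[0, 1]) F r i j)%R.

(* R^{2N} and R^{4N} are indexed by 'I_(N + N) and 'I_((N + N) + (N + N)), so
   that the N x N blocks are those of [block_mx], [row_mx] and [col_mx]. *)

Definition AN (R : realType) (N : nat) (a : 'I_N -> R -> R) (s : R) : 'M[R]_N :=
  diag_mx (\row_i a i s).

Definition SigmaN (R : realType) (N : nat) (sigma : 'I_N -> R -> R) (s : R) :
    'M[R]_N :=
  diag_mx (\row_i sigma i s).

Definition calA (R : realType) (N : nat) (a : 'I_N -> R -> R) (s : R) :
    'M[R]_(N + N) :=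
  block_mx (AN a s) 0 0 (AN a s).

Definition bbA (R : realType) (N : nat) (a : 'I_N -> R -> R) (s : R) :
    'M[R]_((N + N) + (N + N)) :=
  block_mx (calA a s) 0 0 (calA a s).

Definition Sigmabar (R : realType) (N : nat) (sigma : 'I_N -> R -> R) (s : R) :
    'M[R]_(N + N, N) :=
  col_mx (SigmaN sigma s) 0.

Definition calB (R : realType) (N : nat) : 'M[R]_(N + N, N) :=
  col_mx 1%:M 1%:M.

Definition Itilde (R : realType) (N : nat) : 'M[R]_(N, (N + N) + (N + N)) :=
  row_mx (row_mx (2^-1 *: 1%:M) 1%:M) (row_mx (3^-1 *: 1%:M) (2^-1 *: 1%:M)).

Definition calJ (R : realType) (N : nat) :
    'M[R]_((N + N) + (N + N), N + N) :=
  col_mx 1%:M (2^-1 *: 1%:M).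

Definition Dmx (R : realType) (N : nat) (r : R) : 'M[R]_(N + N) :=
  block_mx 1%:M (- ((1 - r) *: 1%:M)) 0 1%:M.

Definition calT (R : realType) (N : nat) :
    'M[R]_((N + N) + (N + N), N + N) :=
  col_mx (mx_integral01 (fun r : R => Dmx N r))
         (mx_integral01 (fun r : R => r *: Dmx N r)).

Definition Qtilde (R : realType) (N : nat) (q : 'I_N -> 'I_N -> R) : 'M[R]_N :=
  \matrix_(i, j) if i == j then N%:R^-1 * \sum_(k | k != i) q i k
                 else - (q i j / N%:R).

Definition Gamma (R : realType) (N : nat) (gamma : 'I_N -> R) : 'M[R]_N :=
  diag_mx (\row_i gamma i).

Definition Qmx (R : realType) (N : nat) (q : 'I_N -> 'I_N -> R) :
    'M[R]_(N + N) :=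
  block_mx 0 (Qtilde q)^T (Qtilde q) 0.

Definition Qbar (R : realType) (N : nat) (gamma : 'I_N -> R) : 'M[R]_(N + N) :=
  block_mx 0 (Gamma gamma) (Gamma gamma) 0.

Definition p0 (R : realType) (N : nat) (gamma d : 'I_N -> R) : 'cV[R]_(N + N) :=
  - col_mx 0 (Gamma gamma *m (\col_i d i)).

Definition calQ (R : realType) (N : nat) (q : 'I_N -> 'I_N -> R) :
    'M[R]_(N + N) :=
  mx_integral01 (fun r : R => (Dmx N r)^T *m Qmx q *m Dmx N r).

Definition calG (R : realType) (N : nat) (gamma : 'I_N -> R) : 'M[R]_(N + N) :=
  mx_integral01 (fun r : R => (Dmx N r)^T *m Qbar gamma *m Dmx N r).

Definition frakg (R : realType) (N : nat) (gamma d : 'I_N -> R) :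
    'cV[R]_(N + N) :=
  mx_integral01 (fun r : R => (Dmx N r)^T *m p0 gamma d).

Definition Kmx (R : realType) (N : nat) (M0 : 'M[R]_(N + N))
    (M1 : 'M[R]_((N + N) + (N + N))) : 'M[R]_(N, (N + N) + (N + N)) :=
  row_mx (row_mx 0 1%:M *m M0) (row_mx 1%:M 0 *m M0) + Itilde R N *m M1.

(* In the scalar equations, the [0 0] entry turns a 1 x 1 matrix into a
   scalar. *)

Definition solves_M_system (R : realType) (N : nat) (t T : R)
    (a sigma : 'I_N -> R -> R) (q : 'I_N -> 'I_N -> R) (gamma d : 'I_N -> R)
    (M0 : R -> 'M[R]_(N + N)) (M1 : R -> 'M[R]_((N + N) + (N + N)))
    (M2 : R -> 'cV[R]_((N + N) + (N + N))) (M3 : R -> R) : Prop :=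
  [/\ (forall s, s \in `[t, T] ->
         exists2 dM0 : 'M[R]_(N + N),
           is_derive_within `[t, T] M0 s dM0 &
           dM0 + (calA a s)^T *m M0 s + M0 s *m calA a s + Qmx q = 0)
      /\ M0 T = Qbar gamma,
      (forall s, s \in `[t, T] ->
         exists2 dM1 : 'M[R]_((N + N) + (N + N)),
           is_derive_within `[t, T] M1 s dM1 &
           dM1 + (bbA a s)^T *m M1 s + M1 s *m bbA a s
             - (Kmx (M0 s) (M1 s))^T *m Kmx (M0 s) (M1 s) = 0)
      /\ M1 T = 0,
      (forall s, s \in `[t, T] ->
         exists2 dM2 : 'cV[R]_((N + N) + (N + N)),
           is_derive_within `[t, T] M2 s dM2 &
           dM2 + (bbA a s)^T *m M2 s
             - (Kmx (M0 s) (M1 s))^T *m Itilde R N *m M2 s = 0)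
      /\ M2 T = col_mx (p0 gamma d) 0 &
      (forall s, s \in `[t, T] ->
         exists2 dM3 : R,
           is_derive_within `[t, T] M3 s dM3 &
           dM3 + \tr (Sigmabar sigma s *m (Sigmabar sigma s)^T
                        *m (M0 s + (calJ R N)^T *m M1 s *m calJ R N))
             - ((Itilde R N *m M2 s)^T *m (Itilde R N *m M2 s)) 0 0 = 0)
      /\ M3 T = 0].

Definition solves_Riccati (R : realType) (N : nat) (t T : R)
    (a sigma : 'I_N -> R -> R) (q : 'I_N -> 'I_N -> R) (gamma d : 'I_N -> R)
    (P : R -> 'M[R]_(N + N)) (p : R -> 'cV[R]_(N + N)) (eta : R -> R) : Prop :=
  [/\ (forall s, s \in `[t, T] ->
         exists2 dP : 'M[R]_(N + N),
           is_derive_within `[t, T] P s dP &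
           dP + (calA a s)^T *m P s + P s *m calA a s + calQ q
             - P s *m calB R N *m (calB R N)^T *m P s = 0)
      /\ P T = calG gamma,
      (forall s, s \in `[t, T] ->
         exists2 dp : 'cV[R]_(N + N),
           is_derive_within `[t, T] p s dp &
           dp + (calA a s)^T *m p s
             - P s *m calB R N *m (calB R N)^T *m p s = 0)
      /\ p T = frakg gamma d &
      (forall s, s \in `[t, T] ->
         exists2 deta : R,
           is_derive_within `[t, T] eta s deta &
           deta + \tr (Sigmabar sigma s *m (Sigmabar sigma s)^T *m P s)
             - ((p s)^T *m calB R N *m (calB R N)^T *m p s) 0 0 = 0)
      /\ eta T = 0].

Definition Pbar (R : realType) (N : nat) (M0 : R -> 'M[R]_(N + N))
    (M1 : R -> 'M[R]_((N + N) + (N + N))) (s : R) : 'M[R]_(N + N) :=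
  mx_integral01 (fun r : R => (Dmx N r)^T *m M0 s *m Dmx N r)
    + (calT R N)^T *m M1 s *m calT R N.

Definition pbar (R : realType) (N : nat)
    (M2 : R -> 'cV[R]_((N + N) + (N + N))) (s : R) : 'cV[R]_(N + N) :=
  (calT R N)^T *m M2 s.

Definition etabar (R : realType) (M3 : R -> R) (s : R) : R := M3 s.

(* Main.v *)
From HB Require Import structures.
Require Import Defs.
From mathcomp Require Import all_boot all_order all_algebra.
From mathcomp Require Import all_classical all_reals all_analysis.
From mathcomp Require Import ring lra.

(** The Riccati system is the image of the larger system under a linear map.
Write [Dmx N r = D0 + r *: S] with [D0 := Dmx N 0] and [S := Dshift], and
let [avgD M] be the integral of [D_r^T M D_r] over [0, 1], so that
[Pbar = avgD M0 + calT^T M1 calT]. Two facts make this map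
[(M0, M1) |-> Pbar] turn one system into the other.

- The block-diagonal drift [calA] commutes with every [D_r], and [calT]
  intertwines [calA] with [bbA]. Hence the linear terms of the equations of [M0]
  and [M1] are carried to [calA^T Pbar + Pbar calA] ([avgD_calA],
  [calT_calA]), the constant terms to [calQ] and [calG] by definition.
- [D_r calB = (r I; I)], whence [calT calB = Itilde^T] and
  [K calT = calB^T Pbar] ([Kmx_calT]). The quadratic term [K^T K] is therefore
  carried to [(calB^T Pbar)^T (calB^T Pbar)] ([Pbar_lyapunov]), and
  [K^T Itilde M2] to [(calB^T Pbar)^T (calB^T pbar)].

The Riccati equation has [Pbar calB] where this computation produces
[(calB^T Pbar)^T], so one needs [Pbar] symmetric ([Pbar_sym]). This holds
because, the source terms being symmetric, [Pbar - Pbar^T] solves a homogeneous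
linear equation with zero terminal value. For [eta], the volatility
[Sigmabar] only sees the first [N] coordinates, on which [D0] is the
identity and [S] vanishes, so that [calT] and [calJ] agree there
([mxtrace_Sigmabar]).

Uniqueness for the Riccati system ([Riccati_unique]), like the symmetry, comes
from one statement on backward linear inequalities: if the derivative of [X] is
bounded by a constant times [X] and [X T = 0], then [X = 0]
([linear_ode_terminal0]). It applies to the difference of two solutions since
[P1 B B^T P1 - P2 B B^T P2 = P1 B B^T (P1 - P2) + (P1 - P2) B B^T P2], with
[P1] and [P2] bounded by continuity on a compact interval. The statement itself
is Gronwall's lemma ([backward_gronwall]) for the sum of the squares of the
entries of [X]. *)

Set Implicit Arguments.
Unset Strict Implicit.
Unset Printing Implicit Defensive.

Import Order.TTheory GRing.Theory Num.Theory.
Import numFieldNormedType.Exports.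

Local Open Scope classical_set_scope.
Local Open Scope ring_scope.

(** * Calculus of derivatives within a set *)

Section DeriveWithin.
Context {R : realType}.
Implicit Types (D : set R) (s : R).

Lemma cvg_bigsum {F : set_system R} {FF : Filter F} (I : Type) (r : seq I)
    (P : pred I) (f : I -> R -> R) (l : I -> R) :
  (forall i, P i -> f i x @[x --> F] --> l i) ->
  \sum_(i <- r | P i) f i x @[x --> F] --> \sum_(i <- r | P i) l i.
Proof. by apply: cvg_big => x; exact: add_continuous. Qed.

Lemma cvg_mxP {m n} {F : set_system R} {FF : Filter F}
    (f : R -> 'M[R]_(m, n)) (l : 'M[R]_(m, n)) :
  f x @[x --> F] --> l <-> forall i j, f x i j @[x --> F] --> l i j.
Proof.
split=> [fl i j|fl].
  exact: (cvg_comp _ _ fl (@coord_continuous R m n i j l)).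
apply/cvgrPdist_le => /= e e0; near=> x.
rewrite /Num.Def.normr/= mx_normrE (bigmax_le _ (ltW e0))//= => i _.
rewrite !mxE/=; move: i; near: x; apply: filter_forall => /= i.
exact: ((cvgrPdist_le _ _).1 (fl i.1 i.2)).
Unshelve. all: by end_near. Qed.

Lemma is_derive_within_mxP {m n} D (F : R -> 'M[R]_(m, n)) s dF :
  is_derive_within D F s dF <->
  forall i j, is_derive_within D (fun x => F x i j) s (dF i j).
Proof.
have E i j : (fun h : R => (h^-1 *: (F (h + s) - F s)) i j) =
    fun h => h^-1 *: (F (h + s) i j - F s i j).
  by apply/funext => h; rewrite !mxE.
by rewrite /is_derive_within cvg_mxP; split=> H i j; have := H i j; rewrite E.
Qed.

Lemma is_derive_withinD {V : normedModType R} D (F G : R -> V) s dF dG :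
  is_derive_within D F s dF -> is_derive_within D G s dG ->
  is_derive_within D (fun x => F x + G x) s (dF + dG).
Proof.
move=> hF hG; rewrite /is_derive_within.
under eq_fun do rewrite opprD addrACA scalerDr.
exact: cvgD.
Qed.

Lemma is_derive_withinB {V : normedModType R} D (F G : R -> V) s dF dG :
  is_derive_within D F s dF -> is_derive_within D G s dG ->
  is_derive_within D (fun x => F x - G x) s (dF - dG).
Proof.
move=> hF hG; rewrite /is_derive_within.
under eq_fun do rewrite opprD addrACA -opprD scalerBr.
exact: cvgB.
Qed.

Lemma is_derive_within_linear {m n m' n'}
    (f : 'M[R]_(m, n) -> 'M[R]_(m', n')) D F s dF :
  linear f -> is_derive_within D F s dF ->
  is_derive_within D (fun x => f (F x)) s (f dF).
Proof.
move=> fl.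
pose fL : {linear _ -> _} := HB.pack f (GRing.isLinear.Build _ _ _ _ f fl).
have fE M k l : f M k l = \sum_i \sum_j M i j * f (delta_mx i j) k l.
  rewrite [M in LHS]matrix_sum_delta -[f]/(fL : _ -> _) linear_sum summxE.
  apply: eq_bigr => i _; rewrite linear_sum summxE; apply: eq_bigr => j _.
  by rewrite linearZ mxE.
move=> /is_derive_within_mxP dFs; apply/is_derive_within_mxP => k l.
rewrite /is_derive_within [f dF k l]fE.
rewrite [X in X @ _](_ : _ = fun h : R => \sum_i \sum_j
    (h^-1 *: (F (h + s) i j - F s i j)) * f (delta_mx i j) k l); last first.
  apply/funext => h; rewrite !fE -sumrB scaler_sumr; apply: eq_bigr => i _.
  rewrite -sumrB scaler_sumr; apply: eq_bigr => j _.
  by rewrite -mulrBl scalerAl.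
apply: cvg_bigsum => i _; apply: cvg_bigsum => j _.
by apply: cvgM; [exact: dFs|exact: cvg_cst].
Qed.

Lemma is_derive_within_continuous D (f : R -> R) :
  (forall s, D s -> exists df : R, is_derive_within D f s df) ->
  {within D, continuous f}.
Proof.
move=> dfs; apply/subspace_continuousP => s Ds.
have [df /cvgrPdist_le/(_ _ ltr01)] := dfs s Ds.
rewrite near_withinE => /nbhs_ballP[d /= d0 dP].
apply/cvgrPdist_le => /= e e0; rewrite near_withinE.
(* Near [s], the difference quotients are at most [K] in absolute value. *)
pose K := `|df| + 1.
have K0 : 0 < K by rewrite ltr_wpDl.
near=> x => Dx.
have [->|xs] := eqVneq x s; first by rewrite subrr normr0 ltW.
have xs0 : x - s != 0 by rewrite subr_eq0.
have xs0' : 0 < `|x - s| by rewrite normr_gt0.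
have : `|df - (x - s)^-1 *: (f (x - s + s) - f s)| <= 1.
  apply: (dP (x - s)) => //=; last by rewrite /= subrK.
  have : ball s d x by near: x; exact: nbhsx_ballx.
  by rewrite -!ball_normE /= sub0r normrN distrC.
rewrite subrK distrC => h1.
have h2 : `|(x - s)^-1 * (f x - f s)| <= K.
  by rewrite /K -lerBlDl; apply: le_trans h1; exact: lerB_dist.
rewrite distrC; have -> : f x - f s = (x - s) * ((x - s)^-1 * (f x - f s)).
  by rewrite mulVKf.
rewrite normrM (le_trans (ler_wpM2l _ h2))// -ler_pdivlMr//.
suff : ball s (e / K) x by rewrite -ball_normE /= distrC => /ltW.
by near: x; apply: nbhsx_ballx; exact: divr_gt0.
Unshelve. all: by end_near. Qed.

Lemma is_derive_within_interior (t T : R) (f : R -> R) s df :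
  s \in `]t, T[ -> is_derive_within `[t, T] f s df -> is_derive s 1 f df.
Proof.
move=> sI dfs.
have /nbhs_ballP[d /= d0 dP] : nbhs s (`]t, T[%classic : set R).
  by apply: open_nbhs_nbhs; split => //; exact: interval_open.
have sN : nbhs (0 : R) [set h | `[t, T]%classic (h + s)].
  apply/nbhs_ballP; exists d => //= h hd.
  apply: (@subset_itv_oo_cc _ _ t T); apply: dP; move: hd.
  by rewrite -!ball_normE /= sub0r opprD addrCA subrr addr0.
have dfl : h^-1 *: (f (h *: (1:R) + s) - f s) @[h --> (0:R)^'] --> df.
  under eq_fun do rewrite [_ *: 1]mulr1.
  apply: cvg_trans dfs; apply: cvg_app => A /= HA.
  have HA' : (0:R)^' (fun h => `[t, T]%classic (h + s) -> A h) by exact: HA.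
  have sN' : (0:R)^' (fun h => `[t, T]%classic (h + s)) by exact: nbhs_dnbhs.
  by apply: filterS2 HA' sN' => h hA hD; exact: hA.
apply: DeriveDef; last exact/cvg_lim.
by apply/cvg_ex; exists df.
Qed.

End DeriveWithin.

(** * The entrywise l1 norm of matrices *)

Section EntrywiseNorm.
Context {R : realType}.

(** This norm is preferred to the maximum norm carried by matrix types because
it is submultiplicative. *)
Definition mx_l1 m n (A : 'M[R]_(m, n)) := \sum_i \sum_j `|A i j|.

Lemma mx_l1_ge0 m n (A : 'M[R]_(m, n)) : 0 <= mx_l1 A.
Proof. by apply: sumr_ge0 => i _; exact: sumr_ge0. Qed.

Lemma mx_l1N m n (A : 'M[R]_(m, n)) : mx_l1 (- A) = mx_l1 A.
Proof.
by apply: eq_bigr => i _; apply: eq_bigr => j _; rewrite mxE normrN.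
Qed.

Lemma mx_l1_tr m n (A : 'M[R]_(m, n)) : mx_l1 A^T = mx_l1 A.
Proof.
rewrite /mx_l1 exchange_big /=.
by apply: eq_bigr => i _; apply: eq_bigr => j _; rewrite mxE.
Qed.

Lemma ler_mx_l1D m n (A B : 'M[R]_(m, n)) c d :
  mx_l1 A <= c -> mx_l1 B <= d -> mx_l1 (A + B) <= c + d.
Proof.
move=> Ac Bd; apply: le_trans (lerD Ac Bd).
rewrite -big_split /=; apply: ler_sum => i _; rewrite -big_split /=.
by apply: ler_sum => j _; rewrite mxE ler_normD.
Qed.

Lemma ler_mx_l1M m n p (A : 'M[R]_(m, n)) (B : 'M[R]_(n, p)) :
  mx_l1 (A *m B) <= mx_l1 A * mx_l1 B.
Proof.
rewrite /mx_l1 mulr_suml; apply: ler_sum => i _; rewrite mulr_suml.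
apply: (@le_trans _ _ (\sum_(j < p) \sum_(k < n) `|A i k| * `|B k j|)).
  apply: ler_sum => j _; rewrite mxE (le_trans (ler_norm_sum _ _ _))//.
  by apply: ler_sum => k _; rewrite normrM.
rewrite exchange_big /=; apply: ler_sum => k _; rewrite -mulr_sumr.
apply: ler_wpM2l => //; rewrite [leRHS](bigD1 k)//= lerDl.
by apply: sumr_ge0 => i' _; exact: sumr_ge0.
Qed.

Lemma ler_mx_l1Ml m n p (A : 'M[R]_(m, n)) (X : 'M[R]_(n, p)) C :
  mx_l1 A <= C -> mx_l1 (A *m X) <= C * mx_l1 X.
Proof.
by move=> AC; apply: (le_trans (ler_mx_l1M _ _)); rewrite ler_wpM2r ?mx_l1_ge0.
Qed.

Lemma ler_mx_l1Mr m n p (X : 'M[R]_(m, n)) (A : 'M[R]_(n, p)) C :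
  mx_l1 A <= C -> mx_l1 (X *m A) <= C * mx_l1 X.
Proof.
move=> AC; apply: (le_trans (ler_mx_l1M _ _)).
by rewrite mulrC ler_wpM2r ?mx_l1_ge0.
Qed.

Lemma mx_l1_dot m n (A B : 'M[R]_(m, n)) :
  `|\sum_i \sum_j A i j * B i j| <= mx_l1 A * mx_l1 B.
Proof.
rewrite /mx_l1 mulr_suml (le_trans (ler_norm_sum _ _ _))//.
apply: ler_sum => i _; rewrite mulr_suml (le_trans (ler_norm_sum _ _ _))//.
apply: ler_sum => j _; rewrite normrM ler_wpM2l//.
rewrite (bigD1 i)//= (bigD1 j)//= -addrA lerDl addr_ge0//.
  exact: sumr_ge0.
by apply: sumr_ge0 => k _; exact: sumr_ge0.
Qed.

(** Expand the square of the sum and bound each product by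
[x * y <= x ^+ 2 / 2 + y ^+ 2 / 2]. *)
Lemma sqr_mx_l1_le m n (A : 'M[R]_(m, n)) :
  mx_l1 A ^+ 2 <= (m * n)%:R * \sum_i \sum_j A i j ^+ 2.
Proof.
rewrite /mx_l1 !pair_big /= expr2 mulr_suml.
set S := \sum_p _ ^+ 2.
apply: (@le_trans _ _ (\sum_(p : 'I_m * 'I_n) \sum_(q : 'I_m * 'I_n)
   ((A p.1 p.2 ^+ 2) / 2 + (A q.1 q.2 ^+ 2) / 2))).
  apply: ler_sum => p _; rewrite mulr_sumr; apply: ler_sum => q _.
  rewrite -[A p.1 p.2 ^+ 2]real_normK ?num_real//.
  rewrite -[A q.1 q.2 ^+ 2]real_normK ?num_real//.
  by have := sqr_ge0 (`|A p.1 p.2| - `|A q.1 q.2|); nra.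
under eq_bigr do rewrite big_split /= sumr_const card_prod !card_ord -mulr_suml.
rewrite big_split /= sumrMnl -mulr_suml sumr_const card_prod !card_ord.
by rewrite -/S -mulr_natl; lra.
Qed.

Lemma bounded_mx_l1 (t T : R) m n (F : R -> 'M[R]_(m, n)) : t <= T ->
  (forall i j, {within `[t, T], continuous (fun s => F s i j)}) ->
  exists C, forall s, s \in `[t, T] -> mx_l1 (F s) <= C.
Proof.
move=> tT Fc.
have : {within `[t, T], continuous (fun s => mx_l1 (F s))}.
  apply/subspace_continuousP => x xI.
  apply: cvg_bigsum => i _; apply: cvg_bigsum => j _.
  by apply: cvg_norm; move: x xI; apply/subspace_continuousP; exact: Fc.
by move=> /(EVT_max tT)[c _ cP]; exists (mx_l1 (F c)).
Qed.

(** The predicate [G] is arbitrary so that the lemma takes each equation of a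
differential system as it is stated. *)
Lemma bounded_is_derive_within (t T : R) m n (F : R -> 'M[R]_(m, n))
    (G : R -> 'M[R]_(m, n) -> Prop) : t <= T ->
  (forall s, s \in `[t, T] -> exists2 dF : 'M[R]_(m, n),
     is_derive_within `[t, T] F s dF & G s dF) ->
  exists C, forall s, s \in `[t, T] -> mx_l1 (F s) <= C.
Proof.
move=> tT dF; apply: bounded_mx_l1 => // i j.
apply: is_derive_within_continuous => s sI.
have [d ds _] := dF s sI; exists (d i j).
exact: (is_derive_within_mxP _ _ _ _).1 ds i j.
Qed.

End EntrywiseNorm.

(** * Uniqueness for linear differential inequalities *)

Section LinearODE.
Context {R : realType}.
Variables (t T : R).

(** The inequality says that [g s * expR (C * s)] is nondecreasing. *)
Lemma backward_gronwall (g dg : R -> R) (C : R) :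
  {within `[t, T], continuous g} ->
  (forall s, s \in `]t, T[ -> is_derive s 1 g (dg s)) ->
  (forall s, s \in `]t, T[ -> - C * g s <= dg s) ->
  g T <= 0 -> forall s, s \in `[t, T] -> g s <= 0.
Proof.
move=> gc gd gC gT s sI.
pose e := fun x : R => expR (C * x).
have ed (x : R) : is_derive x 1 e (C * e x).
  have -> : C * e x = e x * C by rewrite mulrC.
  apply: (@is_derive1_comp _ expR ( *%R C)).
  rewrite -[X in is_derive _ _ _ X]mulr1.
  exact: is_deriveZ.
have hd (x : R) : x \in `]t, T[ ->
    is_derive x 1 (g * e) (e x * (dg x + C * g x)).
  move=> xI; have := gd x xI => ?; apply: is_derive_eq.
  by rewrite /GRing.scale /=; ring.
have hc : {within `[t, T], continuous (g * e)}.
  move=> x; apply: cvgM; first exact: gc.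
  move: x; apply: derivable_within_continuous => x _.
  by have := ed x => ?; exact: ex_derive.
have tT : T \in `[t, T].
  by move: sI; rewrite !in_itv /= lexx andbT => /andP[]; exact: le_trans.
have sT : s <= T by rewrite (itvP sI).
have h_incr : (g * e) s <= (g * e) T.
  apply: (ger0_derive1_le_cc _ _ hc sI tT sT) => x xI; have := hd x xI => ?.
    exact: ex_derive.
  rewrite derive1E derive_val.
  by rewrite mulr_ge0 ?expR_ge0// addrC -lerBlDl sub0r -mulNr gC.
have : g s * e s <= 0.
  by apply: (le_trans h_incr); rewrite mulr_le0_ge0 ?expR_ge0.
by rewrite pmulr_lle0 ?expR_gt0.
Qed.

(** Gronwall's lemma for the sum of the squares of the entries, which unlike a
norm of [X] is differentiable. *)
Lemma linear_ode_terminal0 m n (X : R -> 'M[R]_(m, n)) (C : R) :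
  (forall s, s \in `[t, T] -> exists2 dX : 'M[R]_(m, n),
     is_derive_within `[t, T] X s dX & mx_l1 dX <= C * mx_l1 (X s)) ->
  X T = 0 -> forall s, s \in `[t, T] -> X s = 0.
Proof.
move=> HX XT s sI.
have dXex (x : R) : exists dX : 'M[R]_(m, n), x \in `[t, T] ->
    is_derive_within `[t, T] X x dX /\ mx_l1 dX <= C * mx_l1 (X x).
  have [xI|xI] := boolP (x \in `[t, T]); last by exists 0.
  by have [dX ? ?] := HX x xI; exists dX.
pose dX x := sval (cid (dXex x)).
have dXP x : x \in `[t, T] -> is_derive_within `[t, T] X x (dX x).
  by move=> /(svalP (cid (dXex x)))[].
have dXC x : x \in `[t, T] -> mx_l1 (dX x) <= C * mx_l1 (X x).
  by move=> /(svalP (cid (dXex x)))[].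
pose g : R -> R := \sum_i \sum_j (fun x => X x i j) ^+ 2.
have gE x : g x = \sum_i \sum_j X x i j ^+ 2.
  by rewrite /g fct_sumE; apply: eq_bigr => i _; rewrite fct_sumE.
have Xc i j : {within `[t, T], continuous (fun x => X x i j)}.
  apply: is_derive_within_continuous => x xI; exists (dX x i j).
  exact: (is_derive_within_mxP _ _ _ _).1 (dXP x xI) i j.
have gc : {within `[t, T], continuous g}.
  have -> : g = fun x => \sum_i \sum_j X x i j * X x i j.
    by apply/funext => x; rewrite gE.
  apply/subspace_continuousP => x xI.
  apply: cvg_bigsum => i _; apply: cvg_bigsum => j _.
  by apply: cvgM; move: x xI; apply/subspace_continuousP; exact: Xc.
have gd (x : R) : x \in `]t, T[ ->
    is_derive x 1 g (\sum_i \sum_j (X x i j * dX x i j) *+ 2).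
  move=> xI; apply: is_derive_sum => i; apply: is_derive_sum => j.
  have xI' := subset_itv_oo_cc xI.
  have : is_derive x 1 (fun x => X x i j) (dX x i j).
    apply: is_derive_within_interior xI _.
    exact: (is_derive_within_mxP _ _ _ _).1 (dXP x xI') i j.
  move=> ?; apply: is_derive_eq.
  by rewrite expr1 /GRing.scale /= -mulrA mulr_natl.
have gC x : x \in `]t, T[ ->
    - (2 * `|C| * (m * n)%:R) * g x <= \sum_i \sum_j (X x i j * dX x i j) *+ 2.
  move=> xI; have xI' := subset_itv_oo_cc xI.
  under eq_bigr do rewrite sumrMnl.
  rewrite sumrMnl -mulr_natl.
  have h1 := mx_l1_dot (X x) (dX x).
  have h2 : mx_l1 (X x) * mx_l1 (dX x) <= `|C| * ((m * n)%:R * g x).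
    rewrite gE; apply: (le_trans _ (ler_wpM2l (normr_ge0 C) (sqr_mx_l1_le _))).
    rewrite expr2 mulrCA ler_wpM2l ?mx_l1_ge0// (le_trans (dXC _ xI'))//.
    by rewrite ler_wpM2r ?mx_l1_ge0// ler_norm.
  by move: (le_trans h1 h2); rewrite ler_norml => /andP[]; lra.
have gs0 : g s <= 0.
  apply: (backward_gronwall gc gd gC) => //.
  by rewrite gE XT big1// => i _; rewrite big1// => j _; rewrite mxE expr0n.
move: gs0; rewrite gE => gs0.
apply/matrixP => i j; rewrite mxE; apply/eqP.
rewrite -sqrf_eq0 eq_le sqr_ge0 andbT.
apply: le_trans gs0.
rewrite (bigD1 i)//= (bigD1 j)//= -addrA lerDl addr_ge0//.
  by apply: sumr_ge0 => *; exact: sqr_ge0.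
by apply: sumr_ge0 => k _; apply: sumr_ge0 => l _; exact: sqr_ge0.
Qed.

End LinearODE.

(** * Integrals over [0, 1] of quadratic matrix functions *)

Section Integral.
Context {R : realType}.

Lemma Rintegral01_deriv (p : {poly R}) :
  (\int[@lebesgue_measure R]_(r in `[0, 1]) (p^`()).[r])%R = p.[1] - p.[0].
Proof.
rewrite /Rintegral (@continuous_FTC2 _ _ (horner p)) ?ltr01//.
- by apply: continuous_subspaceT => x; exact: continuous_horner.
- split.
  + by move=> x _; exact: derivable_horner.
  + by apply: cvg_at_right_filter; exact: continuous_horner.
  + by apply: cvg_at_left_filter; exact: continuous_horner.
- by move=> x _; rewrite -derivE.
Qed.

Lemma mx_integral01_quadratic m n (C0 C1 C2 : 'M[R]_(m, n))
    (F : R -> 'M[R]_(m, n)) :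
  (forall r, F r = C0 + r *: C1 + r ^+ 2 *: C2) ->
  mx_integral01 F = C0 + 2^-1 *: C1 + 3^-1 *: C2.
Proof.
move=> FE; apply/matrixP => i j; rewrite !mxE.
pose p : {poly R} := (C0 i j)%:P * 'X + (C1 i j / 2)%:P * 'X^2
  + (C2 i j / 3)%:P * 'X^3.
transitivity (p.[1] - p.[0]); last by rewrite /p !hornerE /=; field.
rewrite -Rintegral01_deriv; apply: eq_Rintegral => r _.
by rewrite FE !mxE /p !poly.derivE !hornerE /=; field.
Qed.

End Integral.

(** * The algebra of the averaged congruence *)

Section Algebra.

Lemma trmxD (R : realType) m n (A B : 'M[R]_(m, n)) : (A + B)^T = A^T + B^T.
Proof. exact: linearD. Qed.

Lemma trmxZ (R : realType) m n (k : R) (A : 'M[R]_(m, n)) :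
  (k *: A)^T = k *: A^T.
Proof. exact: linearZ. Qed.

Lemma sandwich_linear (R : realType) m n m' n' (A : 'M[R]_(m', m))
    (B : 'M[R]_(n, n')) :
  linear (fun M : 'M[R]_(m, n) => A *m M *m B).
Proof. by move=> k M M'; rewrite mulmxDr mulmxDl -scalemxAr -scalemxAl. Qed.

Context {R : realType} {N : nat}.

Definition Dshift : 'M[R]_(N + N) := block_mx 0 1%:M 0 0.

Lemma Dmx_affine (r : R) : Dmx N r = Dmx N 0 + r *: Dshift.
Proof.
rewrite /Dmx /Dshift scale_block_mx add_block_mx !scaler0 !addr0 subr0 scale1r.
by rewrite scalerBl scale1r opprB addrC.
Qed.

Definition avgD (M : 'M[R]_(N + N)) : 'M[R]_(N + N) :=
  mx_integral01 (fun r : R => (Dmx N r)^T *m M *m Dmx N r).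

Lemma avgDE M : avgD M = (Dmx N 0)^T *m M *m Dmx N 0
  + 2^-1 *: ((Dmx N 0)^T *m M *m Dshift + Dshift^T *m M *m Dmx N 0)
  + 3^-1 *: (Dshift^T *m M *m Dshift).
Proof.
apply: mx_integral01_quadratic => r.
rewrite (Dmx_affine r) trmxD trmxZ !mulmxDl !mulmxDr -!scalemxAl -!scalemxAr.
by rewrite scalerDr scalerA -expr2 !addrA.
Qed.

Lemma avgD_linear : linear avgD.
Proof.
move=> k A B; rewrite !avgDE !mulmxDr !mulmxDl -!scalemxAr -!scalemxAl.
rewrite !scalerDr !scalerA ![k * _]mulrC.
by apply/matrixP => i j; rewrite !mxE; ring.
Qed.

Lemma avgDD A B : avgD (A + B) = avgD A + avgD B.
Proof. by have := avgD_linear 1 A B; rewrite !scale1r. Qed.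

Lemma avgD0 : avgD 0 = 0.
Proof. by have := avgD_linear (-1) 0 0; rewrite !scaleN1r !addNr. Qed.

Lemma avgD_tr M : (avgD M)^T = avgD M^T.
Proof.
rewrite !avgDE !(trmxD, trmxZ) !trmx_mul !trmxK !mulmxA.
by congr (_ + 2^-1 *: _ + _); rewrite addrC.
Qed.

Lemma calTE : calT R N =
  col_mx (Dmx N 0 + 2^-1 *: Dshift) (2^-1 *: Dmx N 0 + 3^-1 *: Dshift).
Proof.
congr col_mx.
  rewrite (mx_integral01_quadratic (C0 := Dmx N 0) (C1 := Dshift) (C2 := 0)).
    by rewrite scaler0 addr0.
  by move=> r; rewrite (Dmx_affine r) scaler0 addr0.
rewrite (mx_integral01_quadratic (C0 := 0) (C1 := Dmx N 0) (C2 := Dshift)).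
  by rewrite add0r.
by move=> r; rewrite (Dmx_affine r) add0r scalerDr scalerA expr2.
Qed.

Lemma frakgE gamma d : frakg gamma d = (calT R N)^T *m col_mx (p0 gamma d) 0.
Proof.
rewrite calTE tr_col_mx mul_row_col mulmx0 addr0 /frakg.
rewrite trmxD trmxZ mulmxDl -scalemxAl.
rewrite (mx_integral01_quadratic (C0 := (Dmx N 0)^T *m p0 gamma d)
  (C1 := Dshift^T *m p0 gamma d) (C2 := 0)) ?scaler0 ?addr0// => r.
by rewrite (Dmx_affine r) scaler0 addr0 trmxD trmxZ mulmxDl -scalemxAl.
Qed.

Lemma Dmx0_calB : Dmx N 0 *m calB R N = col_mx 0 1%:M.
Proof. by rewrite mul_block_col !mulmx1 subr0 scale1r subrr add0r. Qed.

Lemma Dshift_calB : Dshift *m calB R N = col_mx 1%:M 0.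
Proof. by rewrite mul_block_col !mulmx1 !addr0 add0r. Qed.

Lemma calT_calB : calT R N *m calB R N = (Itilde R N)^T.
Proof.
rewrite calTE mul_col_mx !mulmxDl -!scalemxAl Dmx0_calB Dshift_calB.
rewrite !scale_col_mx !add_col_mx !scaler0 !addr0 !add0r.
by rewrite /Itilde !tr_row_mx !trmxZ !trmx1.
Qed.

(** The selectors [(0, I)] and [(I, 0)] in [K] are [(D0 calB)^T] and
[(Dshift calB)^T], and [Itilde] is [(calT calB)^T]: all three summands of
[K calT] start with [calB^T]. *)
Lemma Kmx_calT (M0 : 'M[R]_(N + N)) M1 :
  Kmx M0 M1 *m calT R N =
  (calB R N)^T *m (avgD M0 + (calT R N)^T *m M1 *m calT R N).
Proof.
have e0 : row_mx 0 1%:M = (calB R N)^T *m (Dmx N 0)^T.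
  by rewrite -trmx_mul Dmx0_calB tr_col_mx trmx1 trmx0.
have e1 : row_mx 1%:M 0 = (calB R N)^T *m Dshift^T.
  by rewrite -trmx_mul Dshift_calB tr_col_mx trmx1 trmx0.
have eI : Itilde R N = (calB R N)^T *m (calT R N)^T.
  by rewrite -trmx_mul calT_calB trmxK.
rewrite /Kmx mulmxDl e0 e1 eI mulmxDr !mulmxA; congr (_ + _).
rewrite calTE mul_row_col avgDE !mulmxDr -!scalemxAr !mulmxDr !mulmxA.
by rewrite scalerDr !addrA.
Qed.

Section Drift.
Variables (a : 'I_N -> R -> R) (s : R).
Local Notation A := (calA a s).

Lemma calA_Dshift : A *m Dshift = Dshift *m A.
Proof.
by rewrite !mulmx_block !(mulmx0, mul0mx, mulmx1, mul1mx, addr0, add0r).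
Qed.

Lemma calA_Dmx r : A *m Dmx N r = Dmx N r *m A.
Proof.
rewrite !mulmx_block !(mulmx0, mul0mx, mulmx1, mul1mx, addr0, add0r).
by rewrite mulmxN mulNmx -scalemxAr -scalemxAl mulmx1 mul1mx.
Qed.

Lemma calT_calA : calT R N *m A = bbA a s *m calT R N.
Proof.
rewrite calTE mul_block_col mul_col_mx !mul0mx addr0 add0r.
by rewrite !mulmxDl !mulmxDr -!scalemxAl -!scalemxAr calA_Dshift calA_Dmx.
Qed.

Lemma tr_calT_calA : (calT R N)^T *m (bbA a s)^T = A^T *m (calT R N)^T.
Proof. by rewrite -!trmx_mul calT_calA. Qed.

Lemma avgD_calA M : avgD (A^T *m M + M *m A) = A^T *m avgD M + avgD M *m A.
Proof.
pose f M : 'M[R]_(N + N) := A^T *m M + M *m A.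
have fE (E F : 'M[R]_(N + N)) : A *m E = E *m A -> A *m F = F *m A ->
    E^T *m f M *m F = f (E^T *m M *m F).
  move=> AE AF; rewrite /f mulmxDr mulmxDl; congr (_ + _).
    by rewrite !mulmxA -!trmx_mul AE.
  by rewrite -!mulmxA AF.
rewrite -/(f M) -/(f _) !avgDE !fE ?calA_Dshift ?calA_Dmx// /f.
rewrite !(mulmxDr, mulmxDl) -!scalemxAl -!scalemxAr !mulmxDr !mulmxDl.
rewrite !scalerDr.
by apply/matrixP => i j; rewrite !mxE; ring.
Qed.

End Drift.

(** With [U := Sigmabar], [\tr (U U^T X) = \tr (U^T X U)] depends only on
the upper left block of [X]. *)
Lemma mxtrace_Sigmabar (sigma : 'I_N -> R -> R) s (M0 : 'M[R]_(N + N)) M1 :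
  \tr (Sigmabar sigma s *m (Sigmabar sigma s)^T
         *m (M0 + (calJ R N)^T *m M1 *m calJ R N)) =
  \tr (Sigmabar sigma s *m (Sigmabar sigma s)^T
         *m (avgD M0 + (calT R N)^T *m M1 *m calT R N)).
Proof.
set U := Sigmabar sigma s.
have U0 : Dmx N 0 *m U = U.
  by rewrite mul_block_col !mul1mx !mulmx0 !mul0mx !addr0.
have U1 : Dshift *m U = 0.
  by rewrite mul_block_col !mulmx0 !mul0mx !addr0 col_mx0.
have UT : calT R N *m U = calJ R N *m U.
  rewrite calTE !mul_col_mx !mulmxDl -!scalemxAl U0 U1 !scaler0 !addr0.
  by rewrite mul1mx.
have avgU : U^T *m avgD M0 *m U = U^T *m M0 *m U.
  rewrite avgDE !(mulmxDr, mulmxDl) -!scalemxAr -!scalemxAl mulmxDr mulmxDl.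
  rewrite !mulmxA -!trmx_mul U0 U1 -!mulmxA U0 U1.
  by rewrite !(trmx0, mulmx0, mul0mx, addr0, scaler0).
rewrite -!mulmxA ![\tr (U *m _)]mxtrace_mulC !mulmxA.
by rewrite !(mulmxDr, mulmxDl) avgU !mulmxA -!trmx_mul -!mulmxA UT.
Qed.

End Algebra.

(** * The Riccati system *)

Section Riccati.
Context {R : realType} {N : nat}.
Variables (t T : R) (a sigma : 'I_N -> R -> R).
Hypothesis tT : t <= T.
Hypothesis ac : forall i, {within `[t, T], continuous (a i)}.

Lemma bounded_calA : exists C, forall s, s \in `[t, T] -> mx_l1 (calA a s) <= C.
Proof.
have c0 : {within `[t, T], continuous (fun=> 0 : R)}.
  by move=> x; exact: cvg_cst.
have cAN k l : {within `[t, T], continuous (fun s => AN a s k l)}.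
  have -> : (fun s => AN a s k l) = if k == l then a k else fun=> 0.
    by apply/funext => s; rewrite !mxE; case: eqP => // <-.
  by case: eqP.
apply: bounded_mx_l1 => // i j.
have -> : (fun s => calA a s i j) = fun s =>
    match fintype.split i, fintype.split j with
    | inl k, inl l => AN a s k l | inr k, inr l => AN a s k l | _, _ => 0
    end.
  apply/funext => s; rewrite !mxE.
  by case: fintype.split => k; rewrite !mxE; case: fintype.split => l;
     rewrite ?mxE.
by case: fintype.split => k; case: fintype.split => l.
Qed.

Lemma Riccati_unique q gamma d (P1 P2 : R -> 'M[R]_(N + N))
    (p1 p2 : R -> 'cV[R]_(N + N)) (eta1 eta2 : R -> R) :
  solves_Riccati t T a sigma q gamma d P1 p1 eta1 ->
  solves_Riccati t T a sigma q gamma d P2 p2 eta2 ->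
  forall s, s \in `[t, T] -> [/\ P1 s = P2 s, p1 s = p2 s & eta1 s = eta2 s].
Proof.
move=> [[dP1 P1T] [dp1 p1T] [deta1 eta1T]] [[dP2 P2T] [dp2 p2T] [deta2 eta2T]].
have [CA bA] := bounded_calA.
have [C1 b1] := bounded_is_derive_within tT dP1.
have [C2 b2] := bounded_is_derive_within tT dP2.
pose BB := calB R N *m (calB R N)^T.
have bP1 s : s \in `[t, T] -> mx_l1 (P1 s *m BB) <= C1 * mx_l1 BB.
  move=> sI; rewrite (le_trans (ler_mx_l1Mr _ (lexx _)))// mulrC.
  by rewrite ler_wpM2r ?mx_l1_ge0// b1.
have bP2 s : s \in `[t, T] -> mx_l1 (BB *m P2 s) <= mx_l1 BB * C2.
  move=> sI; rewrite (le_trans (ler_mx_l1Ml _ (lexx _)))//.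
  by rewrite ler_wpM2l ?mx_l1_ge0// b2.
have eP s : s \in `[t, T] -> P1 s = P2 s.
  move=> sI; apply/eqP; rewrite -subr_eq0; apply/eqP.
  apply: (linear_ode_terminal0 (X := fun s => P1 s - P2 s)
    (C := CA + CA + C1 * mx_l1 BB + mx_l1 BB * C2)) sI; last first.
    by rewrite P1T P2T subrr.
  move=> {}s sI; have [d1 hd1 e1] := dP1 s sI; have [d2 hd2 e2] := dP2 s sI.
  exists (d1 - d2); first exact: is_derive_withinB.
  have -> : d1 - d2 = - ((calA a s)^T *m (P1 s - P2 s))
      - (P1 s - P2 s) *m calA a s
      + P1 s *m BB *m (P1 s - P2 s) + (P1 s - P2 s) *m (BB *m P2 s).
    have := congr2 (fun x y => x - y) e1 e2; rewrite subrr => e12.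
    apply/eqP; rewrite -subr_eq0; apply/eqP; apply: etrans e12; rewrite /BB.
    rewrite !mulmxBr !mulmxBl !mulmxA.
    by apply/matrixP => i j; rewrite !mxE; ring.
  rewrite !mulrDl; do 3 try apply: ler_mx_l1D.
  - by rewrite mx_l1N ler_mx_l1Ml// mx_l1_tr bA.
  - by rewrite mx_l1N ler_mx_l1Mr// bA.
  - by rewrite ler_mx_l1Ml// bP1.
  - by rewrite ler_mx_l1Mr// bP2.
have ep s : s \in `[t, T] -> p1 s = p2 s.
  move=> sI; apply/eqP; rewrite -subr_eq0; apply/eqP.
  apply: (linear_ode_terminal0 (X := fun s => p1 s - p2 s)
    (C := CA + C1 * mx_l1 BB)) sI; last by rewrite p1T p2T subrr.
  move=> {}s sI; have [d1 hd1 e1] := dp1 s sI; have [d2 hd2 e2] := dp2 s sI.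
  exists (d1 - d2); first exact: is_derive_withinB.
  have -> : d1 - d2 = - ((calA a s)^T *m (p1 s - p2 s))
      + P1 s *m BB *m (p1 s - p2 s).
    have := congr2 (fun x y => x - y) e1 e2; rewrite subrr => e12.
    apply/eqP; rewrite -subr_eq0; apply/eqP; apply: etrans e12; rewrite /BB.
    rewrite -(eP s sI) !mulmxBr !mulmxA.
    by apply/matrixP => i j; rewrite !mxE; ring.
  rewrite mulrDl; apply: ler_mx_l1D.
  - by rewrite mx_l1N ler_mx_l1Ml// mx_l1_tr bA.
  - by rewrite ler_mx_l1Ml// bP1.
move=> s sI; split; [exact: eP|exact: ep|].
(* [eta1 - eta2] has derivative 0; view it as a 1 x 1 matrix. *)
pose X s : 'M[R]_1 := (eta1 s - eta2 s)%:M.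
suff : X s = 0 by move/matrixP/(_ 0 0); rewrite !mxE mulr1n => /subr0_eq.
apply: (linear_ode_terminal0 (X := X) (C := 0)) sI; last first.
  by rewrite /X eta1T eta2T subrr; apply/matrixP => i j; rewrite !mxE mul0rn.
move=> {}s sI; have [d1 hd1 e1] := deta1 s sI; have [d2 hd2 e2] := deta2 s sI.
exists 0; last by rewrite mul0r /mx_l1 !big_ord1 mxE normr0.
apply/is_derive_within_mxP => i j; rewrite !ord1 mxE.
rewrite [X in is_derive_within _ X](_ : _ = fun x => eta1 x - eta2 x); last first.
  by apply/funext => x; rewrite mxE mulr1n.
have -> : 0 = d1 - d2.
  by move: e1 e2; rewrite (eP s sI) (ep s sI) => e1 e2; lra.
exact: is_derive_withinB.
Qed.

(** The image of the equations of [M0] and [M1]. The right-hand side is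
symmetric whether or not [Pbar] is, and this is what makes [Pbar_sym] provable
from this form of the equation. *)
Lemma Pbar_lyapunov q gamma d M0 M1 M2 M3 :
  solves_M_system t T a sigma q gamma d M0 M1 M2 M3 ->
  forall s, s \in `[t, T] -> exists2 dP : 'M[R]_(N + N),
    is_derive_within `[t, T] (Pbar M0 M1) s dP &
    dP + (calA a s)^T *m Pbar M0 M1 s + Pbar M0 M1 s *m calA a s + calQ q =
    ((calB R N)^T *m Pbar M0 M1 s)^T *m ((calB R N)^T *m Pbar M0 M1 s).
Proof.
move=> [[dM0 _] [dM1 _] _ _] s sI.
have [d0 hd0 e0] := dM0 s sI; have [d1 hd1 e1] := dM1 s sI.
exists (avgD d0 + (calT R N)^T *m d1 *m calT R N).
  apply: is_derive_withinD.
    exact: (is_derive_within_linear avgD_linear hd0).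
  exact: (is_derive_within_linear (@sandwich_linear _ _ _ _ _ _ _) hd1).
have := congr1 (@avgD R N) e0; rewrite -(addrA d0).
rewrite avgDD avgDD avgD_calA avgD0 => E0.
rewrite -Kmx_calT trmx_mul.
have -> : Pbar M0 M1 s = avgD (M0 s) + (calT R N)^T *m M1 s *m calT R N by [].
have -> : calQ q = avgD (Qmx q) by [].
(* [K] is made opaque so that the rewrites below do not expand it. *)
move: (Kmx _ _) e1 => K e1.
have := congr1 (fun M => (calT R N)^T *m M *m calT R N) e1.
rewrite !(mulmxDr, mulmxDl) mulmxN mulNmx mulmx0 mul0mx !mulmxA tr_calT_calA.
move=> E1; have := congr2 +%R E0 E1; rewrite addr0 => E01.
apply/eqP; rewrite -subr_eq0; apply/eqP; apply: etrans E01.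
rewrite -!(mulmxA _ (bbA a s)) -calT_calA !mulmxA.
by apply/matrixP => i j; rewrite !mxE; ring.
Qed.

Lemma Pbar_terminal q gamma d M0 M1 M2 M3 :
  solves_M_system t T a sigma q gamma d M0 M1 M2 M3 ->
  Pbar M0 M1 T = calG gamma.
Proof.
move=> [[_ M0T] [_ M1T] _ _].
by rewrite /Pbar M1T mulmx0 mul0mx addr0 M0T.
Qed.

Lemma Pbar_sym q gamma d M0 M1 M2 M3 :
  solves_M_system t T a sigma q gamma d M0 M1 M2 M3 ->
  forall s, s \in `[t, T] -> (Pbar M0 M1 s)^T = Pbar M0 M1 s.
Proof.
move=> HM s sI; have [CA bA] := bounded_calA.
have dP := Pbar_lyapunov HM; have PT := Pbar_terminal HM.
have Q_sym : (calQ q)^T = calQ q.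
  by rewrite -/(avgD (Qmx q)) avgD_tr /Qmx tr_block_mx !trmx0 trmxK.
have G_sym : (calG gamma)^T = calG gamma.
  by rewrite -/(avgD (Qbar gamma)) avgD_tr /Qbar tr_block_mx !trmx0 tr_diag_mx.
move: (Pbar M0 M1) dP PT => P dP PT.
apply/esym/eqP; rewrite -subr_eq0; apply/eqP.
apply: (linear_ode_terminal0 (X := fun s => P s - (P s)^T)
  (C := CA + CA)) sI; last by rewrite PT G_sym subrr.
move=> {}s sI; have [d1 hd1 e1] := dP s sI.
exists (d1 - d1^T).
  apply: is_derive_withinB => //.
  by apply: is_derive_within_linear hd1; exact: linearP.
have -> : d1 - d1^T = - ((calA a s)^T *m (P s - (P s)^T))
    - (P s - (P s)^T) *m calA a s.
  have := congr2 (fun x y => x - y^T) e1 e1.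
  rewrite [X in _ = _ - X]trmx_mul trmxK subrr !trmxD !trmx_mul trmxK Q_sym.
  move=> e2; apply/eqP; rewrite -subr_eq0; apply/eqP; apply: etrans e2.
  by rewrite mulmxBr mulmxBl; apply/matrixP => i j; rewrite !mxE; ring.
rewrite mulrDl; apply: ler_mx_l1D; rewrite mx_l1N.
- by rewrite ler_mx_l1Ml// mx_l1_tr bA.
- by rewrite ler_mx_l1Mr// bA.
Qed.

Lemma Pbar_solves_Riccati q gamma d M0 M1 M2 M3 :
  solves_M_system t T a sigma q gamma d M0 M1 M2 M3 ->
  solves_Riccati t T a sigma q gamma d (Pbar M0 M1) (pbar M2) (etabar M3).
Proof.
move=> HM; have [_ _ [dM2 M2T] [dM3 M3T]] := HM.
have PBt s : s \in `[t, T] ->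
    ((calB R N)^T *m Pbar M0 M1 s)^T = Pbar M0 M1 s *m calB R N.
  by move=> sI; rewrite trmx_mul trmxK (Pbar_sym HM sI).
have Bp s : (calB R N)^T *m pbar M2 s = Itilde R N *m M2 s.
  by rewrite /pbar mulmxA -trmx_mul calT_calB trmxK.
split; split => //.
- move=> s sI; have [dP hdP e] := Pbar_lyapunov HM sI; exists dP => //.
  by rewrite e PBt// !mulmxA subrr.
- exact: Pbar_terminal HM.
- move=> s sI; have [d2 hd2 e2] := dM2 s sI; exists ((calT R N)^T *m d2).
    by apply: is_derive_within_linear hd2; exact: linearP.
  rewrite -PBt// -!mulmxA Bp -Kmx_calT trmx_mul mulmxA.
  rewrite [X in (calA a s)^T *m X]/pbar (mulmxA (calA a s)^T) -tr_calT_calA.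
  have := congr1 (mulmx (calT R N)^T) e2.
  by rewrite mulmx0 mulmxBr mulmxDr !mulmxA.
- by rewrite frakgE -M2T.
- move=> s sI; have [d3 hd3 e3] := dM3 s sI; exists d3 => //.
  have pB : (pbar M2 s)^T *m calB R N = (Itilde R N *m M2 s)^T.
    by rewrite -Bp [RHS]trmx_mul trmxK.
  by rewrite pB -(mulmxA _ _ (pbar M2 s)) Bp -e3 mxtrace_Sigmabar.
Qed.

End Riccati.

Theorem proposition5p1 (R : realType) (N : nat) (hN : (1 <= N)%N)
    (t T : R) (h0t : 0 <= t) (htT : t <= T)
    (a sigma : 'I_N -> R -> R)
    (ha : forall i, {within `[0, T], continuous (a i)})
    (hsigma : forall i, {within `[0, T], continuous (sigma i)})
    (q : 'I_N -> 'I_N -> R) (hq : forall i j, 0 <= q i j)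
    (gamma : 'I_N -> R) (hgamma : forall i, 0 <= gamma i)
    (d : 'I_N -> R)
    (M0 : R -> 'M[R]_(N + N)) (M1 : R -> 'M[R]_((N + N) + (N + N)))
    (M2 : R -> 'cV[R]_((N + N) + (N + N))) (M3 : R -> R)
    (hM : solves_M_system t T a sigma q gamma d M0 M1 M2 M3) :
  solves_Riccati t T a sigma q gamma d (Pbar M0 M1) (pbar M2) (etabar M3) /\
  (forall (P : R -> 'M[R]_(N + N)) (p : R -> 'cV[R]_(N + N)) (eta : R -> R),
     solves_Riccati t T a sigma q gamma d P p eta ->
     forall s, s \in `[t, T] ->
       [/\ P s = Pbar M0 M1 s, p s = pbar M2 s & eta s = etabar M3 s]).
Proof.
have ac i : {within `[t, T], continuous (a i)}.
  apply: continuous_subspaceW (ha i) => s /=.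
  by rewrite !in_itv /= => /andP[ts ->]; rewrite (le_trans h0t ts).
have hbar := Pbar_solves_Riccati htT ac hM.
split => // P p eta hP s sI.
exact: (Riccati_unique htT ac hP hbar sI).
Qed.
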